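(* Let $n$ and $k$ be positive integers with $k\le n$, and let $m$ be a nonnegative integer. Consider an airplane with $n$ seats numbered $1,\dots,n$ and $n$ passengers numbered $1,\dots,n$, passenger $i$ being assigned seat $i$. Passengers board one at a time in the order $1,2,\dots,n$. Passengers $1,\dots,k$ are absent-minded: when it is such a passenger's turn, he chooses a seat uniformly at random among the currently unoccupied seats. Each passenger $i>k$ sits in seat $i$ if it is unoccupied, and otherwise chooses a seat uniformly at random among the currently unoccupied seats. Call a passenger misseated if he does not end up in his assigned seat. Then the probability $P_{n,k}(m)$ that exactly $m$ passengers are misseated is \[ P_{n,k}(m)=\frac{(-1)^m(n-k)!}{n!}\binom{k}{m}+\frac{1}{n!}\sum_{s=1}^{k}\left[{n-k+1 \atop m-s+1}\right]\binom{k}{s}\, s!\sum_{\ell=1}^{s}\frac{(-1)^{s-\ell}\,\ell^{m-s}}{(s-\ell)!}. \]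
   Context: Here $\left[{i \atop j}\right]$ denotes the unsigned Stirling number of the first kind (the number of permutations of $i$ elements with exactly $j$ disjoint cycles), with the conventions $\left[{p \atop 0}\right]=0$ and $\left[{p \atop -q}\right]=0$ for positive integers $p,q$. The binomial coefficient $\binom{k}{m}$ is interpreted as $0$ when $m>k$. *)

(* Defs.v *)
From mathcomp Require Import all_boot all_order all_algebra.
Set Implicit Arguments. Unset Strict Implicit. Unset Printing Implicit Defensive.
Import Order.TTheory GRing.Theory Num.Theory.
Local Open Scope ring_scope.

Fixpoint stirling1 (p q : nat) : nat :=
  match p, q with
  | 0, 0 => 1
  | 0, _.+1 => 0
  | _.+1, 0 => 0
  | p'.+1, q'.+1 => (p' * stirling1 p' q + stirling1 p' q')%N
  end.

Definition stirling1z (p : nat) (q : int) : nat :=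
  match q with
  | Posz j => stirling1 p j
  | Negz _ => 0
  end.

(* The boarding process.  Seats and passengers are numbered 1..n.
   [seat_prob n k r i occ m] is the probability that, when passengers
   i, i+1, ..., i+r-1 board (in this order) with the seats in [occ]
   already occupied, exactly m of them end up misseated.
   Passengers j <= k choose uniformly among free seats; passengers j > k
   take seat j if free, otherwise choose uniformly among free seats. *)
Fixpoint seat_prob (n k r i : nat) (occ : seq nat) (m : nat) : rat :=
  match r with
  | 0 => if m == 0%N then 1 else 0
  | r'.+1 =>
    let free := [seq s <- iota 1 n | s \notin occ] in
    if (k < i)%N && (i \notin occ) then seat_prob n k r' i.+1 (i :: occ) m
    else (size free)%:R^-1 *
         \sum_(s <- free)
           (if s == i then seat_prob n k r' i.+1 (s :: occ) m
            else match m with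
                 | 0 => 0
                 | m'.+1 => seat_prob n k r' i.+1 (s :: occ) m'
                 end)
  end.

Definition P (n k m : nat) : rat := seat_prob n k n 1 [::] m.

(* Main.v *)
(* The generating polynomial of the number of
   misseated passengers is averaged over random configurations: fix a set D of
   occupied seats and let l further seats, uniform outside D, be occupied, with
   all of D below the next passenger j.  If j is not absent-minded, this
   distribution is preserved: either seat j is free and j joins D, or it is
   among the l random seats, and moving its occupant to a uniform free seat
   restores a uniform l-set outside D + j; so one passenger multiplies the
   average by 1 + l X / r, where r seats are still free.  For an absent-minded
   passenger, writing his weight as X + (1 - X) [he takes his own seat] either
   increases l or adds j to D.  Iterating, with M = n - k,
     n! GF = sum_l C(k,l) l! X^l (1 - X)^(k-l) prod_(1 <= R <= M) (R + l X),
   and the last product is a rising factorial, expanded by Stirling numbers. *)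
Require Import Defs.
From mathcomp Require Import all_boot all_order all_algebra.
From mathcomp Require Import ring zify.
Import Order.TTheory GRing.Theory Num.Theory.
Local Open Scope ring_scope.

(** * Generating polynomial of the boarding process *)

(* [A] is the set of occupied seats and [r] the number of passengers still to
   board; seats are 0-based, so the next passenger is [N - r'] when [r = r'.+1].
   [k <= N - r'] then says that he is not absent-minded. *)
Fixpoint misseated_poly (N k r : nat) (A : {set 'I_N.+1}) : {poly rat} :=
  if r is r'.+1 then
    let j := inord (N - r') in
    if (k <= N - r')%N && (j \notin A) then misseated_poly N k r' (j |: A)
    else r%:R^-1 *: \sum_(s | s \notin A)
                      (if s == j then 1 else 'X) * misseated_poly N k r' (s |: A)
  else 1.

(** The hypothesis [#|A| + r = N.+1] makes the number of free seats equal to [r], so both recursions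
    average with the same factor. The ordinal [s] stands for the seat numbered [s.+1]. *)
Lemma seat_prob_coef (N k r : nat) (A : {set 'I_N.+1}) (occ : seq nat) (m : nat) :
  (#|A| + r = N.+1)%N ->
  (forall s : 'I_N.+1, (s.+1 \in occ) = (s \in A)) ->
  seat_prob N.+1 k r (N.+1 - r).+1 occ m = (misseated_poly N k r A)`_m.
Proof.
elim: r A occ m => [|r IHr] A occ m cardA occA.
  by rewrite /= coef1; case: (m == 0%N).
have r_le : (r <= N)%N by lia.
have jE : (inord (N - r) : 'I_N.+1) = (N - r)%N :> nat.
  by rewrite inordK ?ltnS ?leq_subr.
have step (s : 'I_N.+1) m' : s \notin A ->
    seat_prob N.+1 k r (N - r).+2 (s.+1 :: occ) m' =
    (misseated_poly N k r (s |: A))`_m'.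
  move=> sA; rewrite -subSn //; apply: IHr => [|t]; first by rewrite cardsU1 sA; lia.
  by rewrite !inE occA eqSS.
rewrite subSS /= -jE occA ltnS jE.
case: ifP => [/andP[_ jA]|_]; first by rewrite -step // jE.
rewrite coefZ -[if 1%N \notin occ then _ else _]/[seq s <- iota 1 N.+1 | s \notin occ].
rewrite size_filter -sum1_count big_filter -[iota _ _]/(index_iota 1 N.+2).
rewrite !big_add1 /= !big_mkord.
have -> : (\sum_(s < N.+1 | s.+1 \notin occ) 1 = r.+1)%N.
  under eq_bigl do rewrite occA.
  rewrite sum1_card -[LHS]/#|[predC A]| -cardsE cardsCs card_ord.
  by rewrite (_ : ~: _ = A); [lia | apply/setP => s; rewrite !inE negbK].
congr (_ * _); rewrite coef_sum; apply: eq_big => [s|s]; first by rewrite occA.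
rewrite occA eqSS -[s == inord _]val_eqE /= jE => sA.
case: ifP => _; first by rewrite mul1r -step.
by case: m => [|m]; rewrite coefXM //= -step.
Qed.

Lemma misseated_polyS (N k r : nat) (A : {set 'I_N.+1}) :
  let j : 'I_N.+1 := inord (N - r) in
  misseated_poly N k r.+1 A =
  if (k <= N - r)%N && (j \notin A) then misseated_poly N k r (j |: A)
  else r.+1%:R^-1 *: \sum_(s | s \notin A)
                        (if s == j then 1 else 'X) * misseated_poly N k r (s |: A).
Proof. by []. Qed.

Arguments misseated_poly : simpl never.

(** * Averaging over random sets of occupied seats *)

(** Double counting of pairs (C, s) with s in C: each C of size [l.+1] arises once from each of its
    elements. *)
Lemma sum_subset_pick (V : nmodType) (T : finType) (U : {set T}) (l : nat)
    (f : {set T} -> V) :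
  \sum_(B : {set T} | (B \subset U) && (#|B| == l)) \sum_(s in U :\: B) f (s |: B) =
  (\sum_(B : {set T} | (B \subset U) && (#|B| == l.+1)) f B) *+ l.+1.
Proof.
transitivity
  (\sum_(B : {set T} | (B \subset U) && (#|B| == l.+1)) \sum_(s in B) f B); last first.
  rewrite -sumrMnl; apply: eq_bigr => B /andP[_ /eqP cB].
  by rewrite sumr_const cB.
rewrite (exchange_big_dep (mem U)) /=; last by move=> B s _ /setDP[].
rewrite [RHS](exchange_big_dep (mem U)) /=; last first.
  by move=> B s /andP[/subsetP BU _] /BU.
apply: eq_bigr => s sU.
rewrite [RHS](reindex_onto (fun B => s |: B) (fun B => B :\ s)) /=; last first.
  by move=> B /andP[_ sB]; rewrite setD1K.
apply: eq_bigl => B; rewrite in_setD sU andbT setU11 andbT subUset sub1set sU /=.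
rewrite cardsU1; have [sB|sB] := boolP (s \in B).
  rewrite !andbF; apply/esym/negbTE/negP => /andP[_ /eqP E].
  by move: sB; rewrite -E !inE eqxx.
by rewrite andbT setU1K // eqxx andbT add1n eqSS.
Qed.

(** Splitting the weight 1 of the own seat as X + (1 - X) gives every free seat the same weight X;
    the correction remains only if [j] is free. Absent-minded and displaced passengers are thus
    treated together. *)
Lemma misseated_poly_random (N k r : nat) (A : {set 'I_N.+1}) :
  let j : 'I_N.+1 := inord (N - r) in
  ~~ ((k <= N - r)%N && (j \notin A)) ->
  r.+1%:R * misseated_poly N k r.+1 A =
  'X * \sum_(s in ~: A) misseated_poly N k r (s |: A) +
  (1 - 'X) * (if j \in A then 0 else misseated_poly N k r (j |: A)).
Proof.
move=> j /negbTE random; rewrite misseated_polyS random.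
rewrite mulr_natl -scaler_nat scalerA mulfV ?pnatr_eq0 // scale1r.
rewrite -/j; under [X in _ = 'X * X + _]eq_bigl do rewrite inE.
case: ifPn => jA.
  rewrite mulr0 addr0 mulr_sumr; apply: eq_bigr => s sA.
  by case: eqP sA => // ->; rewrite jA.
rewrite (bigD1 j) //= eqxx [in RHS](bigD1 j) //= mulrDr -addrA mulr_sumr.
rewrite (eq_bigr (fun s => 'X * misseated_poly N k r (s |: A))); last first.
  by move=> s /andP[_ /negbTE ->].
ring.
Qed.

Lemma subset_setCU1 (T : finType) (x : T) (B D : {set T}) :
  (B \subset ~: (x |: D)) = (B \subset ~: D) && (x \notin B).
Proof.
rewrite setCU subsetI andbC -[B \subset ~: [set x]]disjoints_subset.
by rewrite disjoint_sym disjoints1.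
Qed.

(* ['C(#|~: D|, l)] times the average of the proof idea above. *)
Definition extension_sum (N k r : nat) (D : {set 'I_N.+1}) (l : nat) : {poly rat} :=
  \sum_(B : {set 'I_N.+1} | (B \subset ~: D) && (#|B| == l))
    misseated_poly N k r (D :|: B).

Lemma extension_sum_pick (N k r : nat) (D : {set 'I_N.+1}) (l : nat) :
  \sum_(B : {set 'I_N.+1} | (B \subset ~: D) && (#|B| == l))
    \sum_(s in ~: (D :|: B)) misseated_poly N k r (s |: (D :|: B)) =
  extension_sum N k r D l.+1 *+ l.+1.
Proof.
rewrite -sum_subset_pick; apply: eq_bigr => B _.
apply: eq_big => [s|s _]; last by rewrite setUCA.
by rewrite !inE negb_or andbC.
Qed.

Lemma extension_sum_avoid (N k r : nat) (D : {set 'I_N.+1}) (l : nat) (j : 'I_N.+1) :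
  j \notin D ->
  \sum_(B : {set 'I_N.+1} | (B \subset ~: D) && (#|B| == l) && (j \notin B))
    misseated_poly N k r (j |: (D :|: B)) =
  extension_sum N k r (j |: D) l.
Proof.
move=> jD; apply: eq_big => [B|B _]; last by rewrite setUA.
by rewrite subset_setCU1 andbAC.
Qed.

(** The uniform part of the choice adds a random seat to [B]; the correction survives only for [B]
    avoiding [j], and then [j] joins [D]. *)
Lemma extension_sum_absent (N k r : nat) (D : {set 'I_N.+1}) (l : nat) :
  let j : 'I_N.+1 := inord (N - r) in
  (N - r < k)%N -> j \notin D ->
  r.+1%:R * extension_sum N k r.+1 D l =
  'X * (l.+1%:R * extension_sum N k r D l.+1) +
  (1 - 'X) * extension_sum N k r (j |: D) l.
Proof.
move=> j lt_k jD.
rewrite [l.+1%:R * _]mulr_natl -extension_sum_pick -extension_sum_avoid // !mulr_sumr.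
rewrite [X in _ = _ + X]big_mkcondr -big_split /=; apply: eq_bigr => B _.
rewrite misseated_poly_random; last by rewrite leqNgt lt_k.
rewrite -/j inE (negbTE jD) /=.
by case: ifP => _ //=; rewrite ?mulr0.
Qed.

(** Sets [B] without [j] give the term [r.+1%:R], since the passenger takes [j]. For the others,
    removing [j] and adding his random seat yields each [l]-set outside [j |: D] exactly [l]
    times. *)
Lemma extension_sum_present (N k r : nat) (D : {set 'I_N.+1}) (l : nat) :
  let j : 'I_N.+1 := inord (N - r) in
  (k <= N - r)%N -> j \notin D ->
  r.+1%:R * extension_sum N k r.+1 D l =
  (r.+1%:R + l%:R * 'X) * extension_sum N k r (j |: D) l.
Proof.
move=> j le_k jD; rewrite /extension_sum (bigID (fun B : {set _} => j \notin B)) /=.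
rewrite mulrDr mulrDl; congr (_ + _).
  rewrite -/(extension_sum N k r (j |: D) l) -extension_sum_avoid //.
  congr (_ * _); apply: eq_bigr => B /andP[_ jB].
  by rewrite misseated_polyS le_k -/j inE negb_or jD jB.
rewrite -/(extension_sum N k r (j |: D) l).
rewrite mulr_sumr.
transitivity ('X * \sum_(B : {set 'I_N.+1} |
    (B \subset ~: D) && (#|B| == l) && (j \in B))
    \sum_(s in ~: (D :|: B)) misseated_poly N k r (s |: (D :|: B))).
  rewrite mulr_sumr; apply: eq_big => [B|B]; first by rewrite negbK.
  rewrite negbK => /andP[_ jB].
  by rewrite misseated_poly_random -/j inE jB orbT ?andbF // mulr0 addr0.
rewrite [_ * 'X]mulrC -mulrA; congr (_ * _).
(* For [l = 0] no [B] contains [j], and both sides vanish. *)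
case: l => [|l].
  rewrite mul0r big_pred0 // => B; apply/negbTE/negP => /andP[/andP[_]].
  by rewrite cards_eq0 => /eqP ->; rewrite inE.
rewrite mulr_natl -extension_sum_pick.
rewrite (reindex_onto (fun B => j |: B) (fun B => B :\ j)) /=; last first.
  by move=> B /andP[_ jB]; rewrite setD1K.
under eq_bigr do rewrite [D :|: _]setUCA [j |: (D :|: _)]setUA.
apply: eq_bigl => B.
rewrite setU11 andbT subUset sub1set inE jD /= cardsU1.
rewrite subset_setCU1.
have [jB|jB] := boolP (j \in B).
  rewrite !andbF; apply/negbTE/negP => /andP[_ /eqP E].
  by move: jB; rewrite -E !inE eqxx.
by rewrite setU1K // eqxx !andbT add1n eqSS.
Qed.

(** The first hypothesis says that no remaining passenger is absent-minded; the bound on [D] keeps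
    the next seat [j] outside [D] at every step. *)
Lemma extension_sum_present_prod (N k r : nat) (D : {set 'I_N.+1}) (l : nat) :
  (r + k <= N.+1)%N -> (#|D| + l + r = N.+1)%N ->
  {in D, forall s : 'I_N.+1, s < N.+1 - r}%N ->
  r`!%:R * extension_sum N k r D l = \prod_(R < r) (R.+1%:R + l%:R * 'X).
Proof.
elim: r D => [|r IHr] D le_rk card_D lt_D.
  (* With everybody seated, [B] can only be the whole complement of [D]. *)
  rewrite big_ord0 mul1r /extension_sum (big_pred1 (~: D)) // => B.
  have card_CD : #|~: D| = l by have := cardsC D; rewrite card_ord; lia.
  apply/andP/eqP => [[BD /eqP card_B]|->]; last by rewrite card_CD.
  by apply/eqP; rewrite eqEcard BD card_B card_CD /=.
set j : 'I_N.+1 := inord (N - r).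
have jE : j = (N - r)%N :> nat by rewrite inordK ?ltnS ?leq_subr.
have jD : j \notin D by apply/negP => /lt_D; rewrite jE; lia.
rewrite big_ord_recr /= -(IHr (j |: D)) ?cardsU1 ?jD; try lia.
  by rewrite factS natrM -mulrA mulrCA extension_sum_present; [ring | lia | ].
by move=> s; rewrite !inE => /orP[/eqP->|/lt_D]; rewrite ?jE; lia.
Qed.

(** * Iteration over the absent-minded passengers *)

(** This is the induction step for [extension_sum_absent_sum]: [i] counts the passengers who raise
    [l], Pascal's rule merges the two alternatives, and the falling factorial collects the factors
    l+1, ..., l+i. *)
Lemma sum_binomial_step (R : comNzRingType) (x : R) (q l : nat) (F : nat -> R) :
  x * (l.+1%:R * \sum_(i < q.+1) 'C(q, i)%:R * ((l.+1 + i) ^_ i)%:R *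
                   (x ^+ i * (1 - x) ^+ (q - i) * F (l.+1 + i)%N)) +
  (1 - x) * \sum_(i < q.+1) 'C(q, i)%:R * ((l + i) ^_ i)%:R *
              (x ^+ i * (1 - x) ^+ (q - i) * F (l + i)%N) =
  \sum_(i < q.+2) 'C(q.+1, i)%:R * ((l + i) ^_ i)%:R *
    (x ^+ i * (1 - x) ^+ (q.+1 - i) * F (l + i)%N).
Proof.
pose G i : R := ((l + i) ^_ i)%:R * (x ^+ i * (1 - x) ^+ (q.+1 - i) * F (l + i)%N).
have -> : \sum_(i < q.+2) 'C(q.+1, i)%:R * ((l + i) ^_ i)%:R *
    (x ^+ i * (1 - x) ^+ (q.+1 - i) * F (l + i)%N) =
    \sum_(i < q.+1) 'C(q, i)%:R * G i.+1 + \sum_(i < q.+2) 'C(q, i)%:R * G i.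
  rewrite !(big_ord_recl q.+1) /= !bin0 addrCA -big_split /=; congr (_ + _).
    by rewrite -mulrA.
  by apply: eq_bigr => i _; rewrite -mulrA -/(G i.+1) binS natrD mulrDl addrC.
rewrite [X in _ = _ + X]big_ord_recr /= bin_small // mul0r addr0 !mulr_sumr.
congr (_ + _); apply: eq_bigr => i _; rewrite /G.
  (* The lowest factor of the falling factorial is the multiplier [l.+1] of the first sum. *)
  rewrite addSnnS ffactnSr subSS natrM (_ : l + i.+1 - i = l.+1)%N; last by lia.
  by rewrite exprS; ring.
by rewrite subSn ?exprS; [ring | rewrite -ltnS].
Qed.

Lemma extension_sum_absent_sum (N k q : nat) (D : {set 'I_N.+1}) (l : nat) :
  (k <= N.+1)%N -> (q <= k)%N -> (#|D| + l + (N.+1 - k + q) = N.+1)%N ->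
  {in D, forall s : 'I_N.+1, s < k - q}%N ->
  (N.+1 - k + q)`!%:R * extension_sum N k (N.+1 - k + q) D l =
  \sum_(i < q.+1) 'C(q, i)%:R * ((l + i) ^_ i)%:R * ('X ^+ i * (1 - 'X) ^+ (q - i) *
     \prod_(R < N.+1 - k) (R.+1%:R + (l + i)%:R * 'X)).
Proof.
move=> le_kn; elim: q D l => [|q IHq] D l le_qk card_D lt_D.
  rewrite big_ord1 !addn0 ffactn0 bin0 !expr0 !mul1r.
  by apply: extension_sum_present_prod => //; [lia | lia | move=> s /lt_D; lia].
rewrite addnS.
set r := (N.+1 - k + q)%N.
set j : 'I_N.+1 := inord (N - r).
have jE : j = (N - r)%N :> nat by rewrite inordK ?ltnS ?leq_subr.
have jD : j \notin D by apply/negP => /lt_D; rewrite jE; lia.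
have lt_jD : {in j |: D, forall s : 'I_N.+1, s < k - q}%N.
  by move=> s; rewrite !inE => /orP[/eqP->|/lt_D]; rewrite ?jE; lia.
have lt_D' : {in D, forall s : 'I_N.+1, s < k - q}%N by move=> s /lt_D; lia.
rewrite factS natrM -mulrA mulrCA extension_sum_absent //; last by lia.
rewrite -/j mulrDr !(mulrCA r`!%:R).
rewrite IHq //; try lia.
rewrite IHq // ?cardsU1 ?jD; try lia.
apply: (@sum_binomial_step {poly rat} 'X q l
  (fun i => \prod_(R < N.+1 - k) (R.+1%:R + i%:R * 'X))).
Qed.

(** * Coefficient extraction and Stirling numbers *)

Lemma coef_natrM (R : nzRingType) (c : nat) (p : {poly R}) (i : nat) :
  (c%:R * p)`_i = c%:R * p`_i.
Proof. by rewrite !mulr_natl coefMn. Qed.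

Lemma coef_subX_exp (q m : nat) :
  ((1 - 'X : {poly rat}) ^+ q)`_m = (-1) ^+ m * 'C(q, m)%:R.
Proof.
elim: q m => [|q IHq] m; first by case: m => [|m]; rewrite coef1 ?mulr0 //= mul1r.
rewrite exprS mulrBl mul1r coefB coefXM !IHq.
case: m => [|m] /=; first by rewrite !bin0 subr0.
by rewrite binS natrD exprS; ring.
Qed.

Arguments stirling1 : simpl never.

(** With y = l X, the rising factorial y (y+1) ... (y+M) has the Stirling numbers of row M+1 as
    coefficients; dividing by y shifts the index to [a.+1]. *)
Lemma coef_prod_stirling1 (M l a : nat) :
  (\prod_(R < M) (R.+1%:R + l%:R * 'X : {poly rat}))`_a =
  (stirling1 M.+1 a.+1)%:R * l%:R ^+ a.
Proof.
elim: M a => [|M IHM] a.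
  rewrite big_ord0 coef1; case: a => [|a]; first by rewrite mulr1.
  by rewrite -[stirling1 1 a.+2]/0%N mul0r.
have stirlingS : stirling1 M.+2 a.+1 = (M.+1 * stirling1 M.+1 a.+1 + stirling1 M.+1 a)%N.
  by [].
rewrite stirlingS {stirlingS} big_ord_recr /= mulrDr coefD mulrC coef_natrM IHM.
rewrite [_ * (_ * 'X)]mulrCA coef_natrM coefMX.
case: a => [|a].
  by rewrite -[stirling1 M.+1 0]/0%N mulr0 addr0 addn0 natrM; ring.
by rewrite IHM /= natrD natrM exprS; ring.
Qed.

Lemma misseated_poly_initial (N k : nat) :
  (k <= N.+1)%N ->
  N.+1`!%:R * misseated_poly N k N.+1 set0 =
  \sum_(l < k.+1) ('C(k, l) * l`!)%:R * ('X ^+ l * (1 - 'X) ^+ (k - l) *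
     \prod_(R < N.+1 - k) (R.+1%:R + l%:R * 'X)).
Proof.
move=> le_kn; have := @extension_sum_absent_sum N k k set0 0 le_kn (leqnn k).
rewrite cards0 !add0n subnK // /extension_sum (big_pred1 set0) => [|B]; last first.
  by rewrite setC0 subsetT cards_eq0.
rewrite setU0 => -> //; last by move=> s; rewrite inE.
by apply: eq_bigr => i _; rewrite add0n ffactnn natrM.
Qed.

(** Both sides equal k! / (k-s)!. *)
Lemma bin_fact_trinomial (k l s : nat) :
  (l <= s <= k)%N ->
  ('C(k, l) * l`! * 'C(k - l, s - l) * (s - l)`! = 'C(k, s) * s`!)%N.
Proof.
case/andP=> le_ls le_sk; have le_lk := leq_trans le_ls le_sk.
have := bin_fact le_lk; have := bin_fact le_sk.
have := bin_fact (leq_sub2r l le_sk).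
rewrite (_ : k - l - (s - l) = k - s)%N; last by lia.
move=> E1 E2 E3; apply/eqP; rewrite -(eqn_pmul2r (fact_gt0 (k - s))).
by apply/eqP; rewrite -[RHS]mulnA E2 -E3 -E1; ring.
Qed.

Lemma subX_exp_sum (q : nat) :
  (1 - 'X : {poly rat}) ^+ q = \sum_(i < q.+1) ((-1) ^+ i * 'C(q, i)%:R) *: 'X^i.
Proof.
rewrite -(poly_def _ (fun i => (-1) ^+ i * 'C(q, i)%:R)); apply/polyP => m.
rewrite coef_poly coef_subX_exp ltnS.
by case: leqP => // lt_qm; rewrite bin_small ?mulr0.
Qed.

(** Here [s] is [l] plus the exponent chosen in the expansion of [(1 - 'X) ^+ (k - l)]. *)
Lemma coef_expansion_term (k l m : nat) (Q : {poly rat}) :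
  (l <= k)%N ->
  (('C(k, l) * l`!)%:R * ('X^l * (1 - 'X) ^+ (k - l) * Q))`_m =
  \sum_(l <= s < k.+1) 'C(k, s)%:R * s`!%:R * ((-1) ^+ (s - l) / (s - l)`!%:R) *
     (if (m < s)%N then 0 else Q`_(m - s)).
Proof.
move=> le_lk; rewrite subX_exp_sum mulr_sumr mulr_suml mulr_sumr coef_sum.
rewrite (_ : index_iota l _ = index_iota (0 + l) k.+1) // big_addn big_mkord subSn //.
apply: eq_bigr => i _; rewrite addnK.
rewrite -scalerAr -exprD -scalerAl -scalerAr coefZ coef_natrM coefXnM.
rewrite [(l + i)%N]addnC mulrA; congr (_ * _).
have le_il : (l <= i + l <= k)%N by have := ltn_ord i; lia.
have := bin_fact_trinomial _ _ _ le_il; rewrite addnK => E.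
have fi : (i`!%:R : rat) != 0 by rewrite pnatr_eq0 -lt0n fact_gt0.
rewrite -natrM -E !natrM; by field.
Qed.

Theorem theorem1 (n k m : nat) (hk : (0 < k)%N) (hkn : (k <= n)%N) :
  P n k m =
    (-1) ^+ m * (n - k)`!%:R / n`!%:R * 'C(k, m)%:R
    + n`!%:R^-1 *
      \sum_(1 <= s < k.+1)
        (stirling1z (n - k + 1) (m%:Z - s%:Z + 1))%:R * 'C(k, s)%:R * s`!%:R *
        \sum_(1 <= l < s.+1)
          ((-1) ^+ (s - l) * ((l%:R : rat) ^ (m%:Z - s%:Z)) / (s - l)`!%:R).
Proof.
case: n hkn => [|N] le_kn; first by case: k hk le_kn.
have fact_neq0 i : (i`!%:R : rat) != 0 by rewrite pnatr_eq0 -lt0n fact_gt0.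
have -> : P N.+1 k m = (misseated_poly N k N.+1 set0)`_m.
  rewrite /P -[1%N](congr1 succn (subnn N.+1)); apply: seat_prob_coef.
    by rewrite cards0.
  by move=> s; rewrite inE.
apply: (mulfI (fact_neq0 N.+1)).
rewrite -coef_natrM misseated_poly_initial // coef_sum.
rewrite mulrDr mulVKf //.
pose term l : rat := (('C(k, l) * l`!)%:R * ('X^l * (1 - 'X) ^+ (k - l) *
  \prod_(R < N.+1 - k) (R.+1%:R + l%:R * 'X)))`_m.
(* The term [l = 0], whose product is the constant (n-k)!, gives the first summand of the
   formula. *)
rewrite -(big_mkord predT term) big_ltn //; congr (_ + _).
  rewrite /term bin0 mul1r !mul1r subn0.
  under [X in _ * X]eq_bigr do rewrite mul0r addr0.
  rewrite -natr_prod -(big_mkord predT succn).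
  rewrite -[\prod_(0 <= i < _) _](big_add1 _ _ _ (N.+1 - k).+1 predT id).
  rewrite -fact_prod mulrC coef_natrM coef_subX_exp.
  by field.
rewrite (eq_big_nat _ _ (F2 := fun l => \sum_(1 <= s < k.+1 | (l <= s)%N)
  'C(k, s)%:R * s`!%:R * ((-1) ^+ (s - l) / (s - l)`!%:R) *
  (stirling1z (N.+1 - k + 1) (m%:Z - s%:Z + 1))%:R *
  (l%:R : rat) ^ (m%:Z - s%:Z))); last first.
  move=> l /andP[l_gt0 le_lk]; rewrite /term coef_expansion_term //.
  rewrite (big_nat_widenl _ 1) //; apply: eq_bigr => s _.
  (* For m < s the power of [l] is nonzero, but the Stirling index m-s+1 is at most 0, so the
     conventions make that factor vanish. *)
  rewrite -[RHS]mulrA; congr (_ * _); case: ltnP => [lt_ms | le_sm].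
    have -> : stirling1z (N.+1 - k + 1) (m%:Z - s%:Z + 1) = 0%N; last by rewrite mul0r.
    rewrite addn1; have : m%:Z - s%:Z + 1 <= 0 by lia.
    by case: (m%:Z - s%:Z + 1) => [[|]|].
  by rewrite coef_prod_stirling1 subzn // -PoszD !addn1.
(* Turning [l <= s] into a conditional summand makes the ranges independent, so the two sums can be
   exchanged. *)
under eq_bigr do rewrite big_mkcond.
rewrite exchange_big_nat.
apply: eq_big_nat => s /andP[s_gt0 le_sk].
rewrite mulr_sumr [RHS](big_nat_widen _ _ k.+1) // [RHS]big_mkcond.
apply: eq_bigr => l _; rewrite ltnS /=; case: ifP => // _; ring.
Qed.
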